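(* Let $0<\alpha<1$ be a given constant. Then there is a constant $c_\alpha>0$ such that for all integers $n\ge1$ and all $\epsilon$ with $3^{-n}\leq\epsilon\leq 1/3$, \[\deg_{\epsilon}(\operatorname{PTP}_{n,\alpha}) \geq c_\alpha\, n^{1/3}\left(\log\frac{1}{\epsilon}\right)^{2/3}.\]
   Context: Let $\mathcal{D}_{n,n}$ denote the set of Boolean $n\times n$ matrices in which every row contains exactly one $1$, viewed as a subset of $\{0,1\}^{n^2}\subseteq\mathbb{R}^{n^2}$. For $0<\alpha<1$, the permutation testing function $\operatorname{PTP}_{n,\alpha}$ has as domain the set of matrices $x\in\mathcal{D}_{n,n}$ for which the number of columns containing a $1$ is either exactly $n$ or at most $\alpha n$; it evaluates to $1$ in the former case (i.e. when $x$ is a permutation matrix) and to $0$ in the latter. For $f\colon X\to\mathbb{R}$ on a finite $X\subseteq\mathbb{R}^N$, $\deg_\epsilon(f)$ is the least total degree of a real polynomial $p$ on $\mathbb{R}^N$ with $|p(x)-f(x)|\leq\epsilon$ for all $x\in X$ (no constraint on $p$ outside $X$).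
   Formalization: The bound is proved for integers n ≥ 1 with αn ≥ 1; when αn < 1 (e.g. n = 1) the zero side of the domain is empty, the function is constantly 1 with approximate degree 0, and the stated inequality fails. *)

(* Defs.v *)
From HB Require Import structures.
From mathcomp Require Import all_boot all_order all_algebra.
From mathcomp Require Import boolp classical_sets functions cardinality.
From mathcomp Require Import reals exp.
(* The notations of mpoly clash with those of mathcomp-analysis. *)
From mathcomp Require Import -(notations) mpoly.

Set Implicit Arguments.
Unset Strict Implicit.
Unset Printing Implicit Defensive.

Import Order.TTheory GRing.Theory Num.Theory.

Local Open Scope classical_set_scope.
Local Open Scope ring_scope.

Section ApproximateDegree.
Variables (R : realType) (N : nat).
Implicit Types (X : set 'rV[R]_N) (f : 'rV[R]_N -> R) (eps : R).

(* The zero polynomial gets degree 0, like every other constant. *)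
Definition total_degree (p : mpoly N R) : nat :=
  (mmeasure mdeg p).-1.

Definition approximants X f eps : set (mpoly N R) :=
  [set p | forall x, X x -> `|meval (x ord0) p - f x| <= eps].

Definition approx_degrees X f eps : set nat :=
  total_degree @` approximants X f eps.

(* The default value of xget is never used for finite X and eps >= 0, by
   approx_degP below. Only the values of f on X matter. *)
Definition approx_deg X f eps : nat :=
  xget 0%N (approx_degrees X f eps `&` lbound (approx_degrees X f eps)).

Lemma interpolation (s : seq 'rV[R]_N) f :
  exists p : mpoly N R, {in s, forall x : 'rV[R]_N, meval (x ord0) p = f x}.
Proof.
pose c (a : R) : mpoly N R := mpolyC N a.
pose X i : mpoly N R := mpolyX R (mnm1 i).
have sep (a b : 'rV[R]_N) : exists q : mpoly N R,
    meval (a ord0) q = 1 /\ (a != b -> meval (b ord0) q = 0).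
  have [->|ab] := eqVneq a b; first by exists 1; rewrite meval1.
  have [i abi] : exists i, a ord0 i != b ord0 i.
    apply/existsP; apply: contra_neqT ab => /existsPn abE.
    by apply/rowP => i; apply/eqP; move: (abE i); rewrite negbK.
  exists (c (a ord0 i - b ord0 i)^-1 * (X i - c (b ord0 i))).
  split=> [|_]; rewrite mevalM mevalB !mevalC mevalXU.
    by rewrite mulVf // subr_eq0.
  by rewrite subrr mulr0.
have [q qP] := choice (fun a =>
  let: existT g gP := choice (sep a) in ex_intro _ g gP).
pose l a := \prod_(b <- undup s) q a b.
have lE (a y : 'rV[R]_N) : y \in s -> meval (y ord0) (l a) = (a == y)%:R.
  move=> ys; rewrite rmorph_prod /=; have [->|ay] := eqVneq a y.
    by apply: big1 => b _; have [] := qP y b.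
  rewrite (bigD1_seq y) ?mem_undup ?undup_uniq //=.
  by have [_ ->//] := qP a y; rewrite mul0r.
exists (\sum_(a <- undup s) c (f a) * l a) => x xs.
rewrite raddf_sum (bigD1_seq x) ?mem_undup ?undup_uniq //=.
rewrite mevalM mevalC lE // eqxx mulr1 big1 ?addr0 // => a ax.
by rewrite mevalM lE // (negbTE ax) mulr0.
Qed.

Lemma approx_degP X f eps : finite_set X -> 0 <= eps ->
  (approx_degrees X f eps `&` lbound (approx_degrees X f eps))
    (approx_deg X f eps).
Proof.
move=> /finite_seqP[s Xs] eps0; apply: xgetPex.
have [p ps] := interpolation s f.
have exD : exists d, `[< approx_degrees X f eps d >].
  exists (total_degree p); apply/asboolP; exists p => // x.
  by rewrite Xs /= => /ps ->; rewrite subrr normr0.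
case: (ex_minnP exD) => d /asboolP Dd dmin.
by exists d; split=> // e De; apply/dmin/asboolP.
Qed.

End ApproximateDegree.

Section PermutationTesting.
Variables (R : realType) (n : nat).
Implicit Types (x : 'M[R]_n) (alpha : R).

Definition row_functional : set 'M[R]_n :=
  [set x | (forall i j, x i j = 0 \/ x i j = 1) /\
           (forall i, exists! j, x i j = 1)].

Definition num_nonzero_cols x : nat := #|[pred j | [exists i, x i j == 1]]|.

(* For 0 < n and alpha * n < 1 this contains only the permutation matrices, since
   num_nonzero_cols x >= 1; PTP is then constant on it and has approximate degree 0. *)
Definition PTP_dom alpha : set 'M[R]_n :=
  [set x | row_functional x /\
           (num_nonzero_cols x = n \/
            (num_nonzero_cols x)%:R <= alpha * n%:R)].

(* Meaningful on PTP_dom alpha only; there alpha < 1 excludes the overlap of the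
   two cases when n > 0. *)
Definition PTP x : R := if num_nonzero_cols x == n then 1 else 0.

Lemma finite_PTP_dom alpha : finite_set (mxvec @` PTP_dom alpha).
Proof.
apply/finite_image.
have sub : PTP_dom alpha `<=`
    range (fun b : 'M[bool]_n => map_mx (fun t : bool => t%:R : R) b).
  move=> x [[x01 _] _]; exists (map_mx (fun a => a == 1) x) => //.
  apply/matrixP => i j; rewrite !mxE.
  by have [->|->] := x01 i j; rewrite ?eqxx // eq_sym oner_eq0.
apply: sub_finite_set sub _; exact/finite_image/finite_finset.
Qed.

End PermutationTesting.

(* Main.v *)
Require Import Defs.
From mathcomp Require Import all_boot all_order all_algebra all_fingroup.
From mathcomp Require Import classical_sets reals exp.
From mathcomp Require Import ring lra zify.
From mathcomp Require Import -(notations) mpoly.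

Set Implicit Arguments.
Unset Strict Implicit.
Unset Printing Implicit Defensive.

Import Order.TTheory GRing.Theory Num.Theory.

(* Let [a] be a uniformly random map from [m] points into a set of [r] of them
   and [tau] an independent uniformly random permutation.  The probability that
   [tau^-1 o a] takes prescribed values at [e] points is a polynomial in [1 / r]
   of degree at most [e], whose value at [0] is the corresponding probability
   for a uniformly random permutation.  Lagrange extrapolation from nodes
   [1 / r_t ~ t^2 / R0], with integers [r_t <= R0] and [t] up to order
   [R0^(1/3)], costs only a constant factor.  So some signed law [nu] of total
   mass at most [3 / 2], carried by maps with at most [R0] values, has the same
   moments as a random permutation up to a degree of order [R0^(1/3)].

   Split the [n] points into [k ~ log (1 / eps)] blocks of size [m ~ n / k] and
   put on each block either a random permutation or [nu].  The resulting average
   of an approximant of too small a degree has degree at most [g ~ alpha k / 4]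
   in the choices made on the blocks, while it is close to [1] when every block
   is permuted and at most [(3 / 2)^k eps] when at most [g] blocks are;
   extrapolating from the latter to the former loses a factor [3^k] only, a
   contradiction.  Hence the degree is at least of order
   [k m^(1/3) ~ n^(1/3) log(1 / eps)^(2/3)]. *)

(** * Counting permutations *)

Section PermutationCounts.
Variable T : finType.
Implicit Types (A : {set T}) (s : seq T) (c : T -> T) (tau : {perm T}).

Lemma card_permT : #|{perm T}| = (#|T|)`!.
Proof.
rewrite -[in RHS]cardsT -card_perm; apply: eq_card => tau.
by rewrite inE; apply/esym/fintype.subsetP => x; rewrite inE.
Qed.

(* Conditioned on [tau] mapping [s] into [A], all points outside [s] are
   equally likely to be mapped into [A]. *)
Lemma card_perm_into A s : uniq s ->
  (\sum_(tau : {perm T} | all (fun x => tau x \in A) s) 1) * #|T| ^_ (size s) =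
  (#|T|)`! * #|A| ^_ (size s).
Proof.
elim: s => [_|x s IHs /= /andP[xs us]].
  by rewrite /= !ffactn0 !muln1 sum1_card card_permT.
pose C y := \sum_(tau : {perm T} | all (fun z => tau z \in A) (y :: s)) 1.
have CE y : y \notin s -> C y = C x.
  move=> ys; rewrite /C (reindex_inj (mulgI (tperm x y))) /=.
  apply: eq_bigl => tau; rewrite permM tpermR; congr (_ && _).
  apply: eq_in_all => z zs; rewrite permM tpermD //.
    by apply: contraNneq xs => ->.
  by apply: contraNneq ys => ->.
(* Double count of the pairs of a [tau] mapping [s] into [A] and a point outside [s] that it also
   maps into [A]. *)
have count_out : \sum_(y | y \notin s) C y =
    (\sum_(tau : {perm T} | all (fun z => tau z \in A) s) 1) * (#|A| - size s).
  rewrite /C (exchange_big_dep (fun tau => all (fun z => tau z \in A) s)) /=;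
    last by move=> y tau _ /andP[].
  rewrite big_distrl /=; apply: eq_bigr => tau stA.
  rewrite mul1n -(card_uniqP us) (eq_bigl [in (tau @^-1: A) :\: [set z in s]]).
    rewrite sum1_card cardsD card_preimset; last exact: perm_inj.
    congr (_ - _)%N; rewrite -[in RHS](cardsE [in s]); congr #|pred_of_set _|.
    apply/setP => z; rewrite !inE andb_idl // => zs.
    exact: (allP stA).
  by move=> y; rewrite !inE stA andbT.
move: count_out; rewrite (eq_bigr (fun=> C x)) => [|y /CE //].
rewrite sum_nat_const.
have -> : #|[pred y | y \notin s]| = #|T| - size s.
  by rewrite -(card_uniqP us) -[#|T|](cardC [in s]) addKn; apply: eq_card.
rewrite -/(C x) !ffactnSr => count_out.
by rewrite -[X in _ * X]mulnC mulnA [C x * _]mulnC count_out mulnAC IHs // mulnA.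
Qed.

(** Conditioned on [tau] agreeing with [c] on [s], the value [tau x] is uniform outside [map c s]:
    compose with transpositions of the values. *)
Lemma card_perm_extend c s : uniq s -> uniq (map c s) ->
  (\sum_(tau : {perm T} | all (fun x => tau x == c x) s) 1) * #|T| ^_ (size s) =
  (#|T|)`!.
Proof.
elim: s => [_ _|x s IHs /= /andP[xs us] /andP[cxs ucs]].
  by rewrite ffactn0 muln1 sum1_card card_permT.
pose C y := \sum_(tau : {perm T} |
  (tau x == y) && all (fun z => tau z == c z) s) 1.
have CE y : y \notin map c s -> C y = C (c x).
  move=> ys; rewrite /C (reindex_inj (mulIg (tperm (c x) y))) /=.
  apply: eq_bigl => tau.
  rewrite permM (canF_eq (tpermK _ _)) tpermR; congr (_ && _).
  apply: eq_in_all => z zs; rewrite permM (canF_eq (tpermK _ _)) tpermD //.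
    by apply: contraNneq cxs => ->; apply: map_f.
  by apply: contraNneq ys => ->; apply: map_f.
have C0 y : y \in map c s -> C y = 0.
  move=> /mapP[z zs ->]; apply: big_pred0 => tau.
  apply/negP => /andP[/eqP tx /allP /(_ z zs)]; rewrite -tx.
  by move=> /eqP/perm_inj zx; rewrite -zx zs in xs.
have total : \sum_y C y = \sum_(tau : {perm T} | all (fun z => tau z == c z) s) 1.
  rewrite /C (exchange_big_dep (fun tau => all (fun z => tau z == c z) s)) /=;
    last by move=> y tau _ /andP[].
  apply: eq_bigr => tau stA; rewrite (eq_bigl (pred1 (tau x))) ?big_pred1_eq //.
  by move=> y; rewrite stA andbT eq_sym.
move: total; rewrite (bigID [in map c s]) /= big1 ?add0n => [|y /C0 //].
rewrite (eq_bigr (fun=> C (c x))) => [|y /CE //]; rewrite sum_nat_const.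
have -> : #|[pred y | y \notin map c s]| = #|T| - size s.
  rewrite -(size_map c) -(card_uniqP ucs) -[#|T|](cardC [in map c s]) addKn.
  exact: eq_card.
rewrite -/(C (c x)) ffactnSr => total.
by rewrite [X in _ * X]mulnC mulnA [C _ * _]mulnC total IHs.
Qed.

End PermutationCounts.

Local Open Scope ring_scope.

(** * Moments of random maps of small range *)

Section RandomMaps.
Variables (F : numFieldType) (T : finType).
Implicit Types (A I : {set T}) (c : T -> T) (e : T -> T -> nat).
Implicit Types (tau : {perm T}) (g : {ffun T -> T}).

Definition map_monomial e g : F := \prod_i \prod_j (g i == j)%:R ^+ e i j.

Definition perm_law g : F :=
  (\sum_(tau : {perm T}) [forall i, tau i == g i])%N%:R / (#|T|)`!%:R.

(* The law of [tau^-1 \o a] for a uniformly random permutation [tau] and an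
   independent uniformly random map [a] with values in [A]. *)
Definition small_range_law A g : F :=
  (\sum_(tau : {perm T}) [forall i, tau (g i) \in A])%N%:R /
  (#|A| ^ #|T| * (#|T|)`!)%N%:R.

Lemma prod_nat_bool (J : finType) (b : pred J) :
  (\prod_j (b j : nat))%N = [forall j, b j].
Proof.
have [/forallP ball|/forallPn[j /negbTE bj]] := boolP [forall j, b j].
  by apply: big1 => j _; rewrite ball.
by rewrite (bigD1 j) //= bj.
Qed.

Lemma sum_perm_law (h : {ffun T -> T} -> bool) :
  \sum_g perm_law g * (h g)%:R =
  (\sum_(tau : {perm T}) h [ffun i => tau i])%N%:R / (#|T|)`!%:R.
Proof.
rewrite (eq_bigr (fun g : {ffun T -> T} =>
    ((\sum_(tau : {perm T}) ([forall i, tau i == g i] * h g))%N)%:R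
      / (#|T|)`!%:R)).
  rewrite -mulr_suml -natr_sum exchange_big /=; congr (_%:R / _).
  apply: eq_bigr => tau _.
  rewrite (bigD1 [ffun i => tau i]) //= big1 ?addn0 => [|g gtau].
    suff -> : [forall i, tau i == [ffun i => tau i] i] by rewrite mul1n.
    by apply/forallP => i; rewrite ffunE.
  case: forallP => // gE; case/eqP: gtau; apply/ffunP => i.
  by rewrite ffunE (eqP (gE i)).
by move=> g _; rewrite /perm_law -big_distrl /= natrM mulrAC.
Qed.

Lemma sum_small_range_law A (h : {ffun T -> T} -> bool) :
  \sum_g small_range_law A g * (h g)%:R =
  (\sum_(tau : {perm T}) \sum_(g : {ffun T -> T})
      ([forall i, tau (g i) \in A] * h g))%N%:R / (#|A| ^ #|T| * (#|T|)`!)%N%:R.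
Proof.
rewrite exchange_big natr_sum mulr_suml; apply: eq_bigr => g _.
by rewrite /small_range_law -big_distrl /= [X in _ = X / _]natrM mulrAC.
Qed.

(** For fixed [tau] the conditions on [g] are independent over the points: on [I] the value is
    forced, elsewhere it ranges over the preimage of [A]. *)
Lemma count_small_range A I c tau :
  (\sum_(g : {ffun T -> T})
     ([forall i, tau (g i) \in A] * [forall i in I, g i == c i]) =
   all (fun y => tau y \in A) (enum (c @: I)) * #|A| ^ (#|T| - #|I|))%N.
Proof.
transitivity (\sum_(g : {ffun T -> T})
    \prod_i ((tau (g i) \in A) && ((i \in I) ==> (g i == c i)) : nat))%N.
  by apply: eq_bigr => g _; rewrite -!prod_nat_bool -big_split /=;
     apply: eq_bigr => i _; rewrite mulnb.
rewrite -(bigA_distr_bigA (fun i y =>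
    ((tau y \in A) && ((i \in I) ==> (y == c i)) : nat))) /=.
rewrite (bigID [in I]) /=; congr (_ * _)%N.
  have -> : all (fun y => tau y \in A) (enum (c @: I)) =
      [forall i, (i \in I) ==> (tau (c i) \in A)].
    apply/allP/forall_inP => [cA i iI|cA y].
      by apply: cA; rewrite mem_enum; apply: imset_f.
    by rewrite mem_enum => /imsetP[i iI ->]; apply: cA.
  rewrite -prod_nat_bool [RHS](bigID [in I]) /=.
  rewrite [X in (_ = _ * X)%N]big1 ?muln1 => [|i /negbTE -> //].
  apply: eq_bigr => i iI; rewrite iI /= (bigD1 (c i)) //= eqxx andbT.
  by rewrite big1 ?addn0 // => y /negbTE ->; rewrite andbF.
rewrite (eq_bigr (fun=> #|A|)).
  rewrite prod_nat_const; congr (_ ^ _)%N.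
  by rewrite -[#|T|](cardC [in I]) addKn; apply: eq_card.
move=> i /negbTE iI; rewrite iI /= -(card_preimset A (@perm_inj _ tau)) -sum1_card.
rewrite [RHS]big_mkcond /=; apply: eq_bigr => y _.
by rewrite !inE andbT; case: (_ \in _).
Qed.

(** The quotient of the falling factorial [r ^_ v] by [r ^ v], as a polynomial in [1 / r]. *)
Definition falling_poly (v : nat) : {poly F} :=
  \prod_(j < v) (1 - j%:R *: 'X).

Lemma size_falling_poly v : (size (falling_poly v) <= v.+1)%N.
Proof.
elim: v => [|v IHv]; rewrite /falling_poly ?big_ord0 ?size_poly1 //.
rewrite big_ord_recr /=; apply: leq_trans (size_polyMleq _ _) _.
have s2 : (size ((1 - v%:R *: 'X)%R : {poly F}) <= 2)%N.
  apply: leq_trans (size_polyD _ _) _; rewrite size_poly1 geq_max /=.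
  by rewrite size_polyN; apply: leq_trans (size_scale_leq _ _) _; rewrite size_polyX.
by rewrite -subn1 leq_subLR; apply: leq_trans (leq_add IHv s2) _; rewrite addn2.
Qed.

Lemma horner_falling_poly0 v : (falling_poly v).[0] = 1.
Proof.
rewrite horner_prod big1 // => j _.
by rewrite hornerD hornerN hornerZ hornerX hornerC mulr0 subr0.
Qed.

Lemma horner_falling_polyV v r : (0 < r)%N ->
  (falling_poly v).[r%:R^-1] = (r ^_ v)%:R / r%:R ^+ v.
Proof.
move=> r0; have rn0 : r%:R != 0 :> F by rewrite pnatr_eq0 -lt0n.
rewrite horner_prod; elim: v => [|v IHv]; first by rewrite big_ord0 ffactn0 divr1.
rewrite big_ord_recr /= IHv ffactnSr hornerD hornerN hornerZ hornerX hornerC.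
have [vr|rv] := leqP v r; last by rewrite ffact_small // !mul0r.
by rewrite natrM natrB // exprSr; field; rewrite rn0 expf_neq0.
Qed.

(** Let [c] take [v] values on [I]. With [r = #|A|] and [m = #|T|], these values all go into [A]
    with probability [r ^_ v / m ^_ v], and then [a] is right on [I] with probability [r ^ - #|I|].
    The product is a polynomial in [1 / r]; its factor [X ^ (#|I| - v)] vanishes at 0 unless [c] is
    injective on [I], as is right for permutations. *)
Lemma partial_map_poly I c : exists2 H : {poly F}, (size H <= #|I|.+1)%N &
  \sum_g perm_law g * [forall i in I, g i == c i]%:R = H.[0] /\
  forall A, (0 < #|A|)%N ->
    \sum_g small_range_law A g * [forall i in I, g i == c i]%:R =
      H.[#|A|%:R^-1].
Proof.
set m := #|T|; set v := #|c @: I|.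
have vI : (v <= #|I|)%N := leq_imset_card _ _.
have vm : (v <= m)%N := max_card _.
have mv0 : (m ^_ v)%:R != 0 :> F by rewrite pnatr_eq0 -lt0n ffact_gt0.
have m0 : (m`!)%:R != 0 :> F by rewrite pnatr_eq0 -lt0n fact_gt0.
exists ((m ^_ v)%:R^-1 *: ('X^(#|I| - v) * falling_poly v)).
  apply: leq_trans (size_scale_leq _ _) _.
  apply: leq_trans (size_polyMleq _ _) _; rewrite size_polyXn.
  rewrite -subn1 leq_subLR; apply: leq_trans (leq_add (leqnn _) (size_falling_poly _)) _.
  by rewrite addSn addnS subnK.
split=> [|A A0].
  rewrite sum_perm_law hornerZ hornerM horner_falling_poly0 mulr1 hornerXn expr0n.
  rewrite subn_eq0.
  have [cinj|ncinj] := boolP (#|c @: I| == #|I|).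
    have vE : v = #|I| by exact/eqP.
    have uI : uniq (map c (enum I)).
      rewrite map_inj_in_uniq ?enum_uniq // => x y; rewrite !mem_enum.
      by apply: (imset_injP cinj).
    have := card_perm_extend (enum_uniq _) uI.
    rewrite -cardE -vE -/m leqnn => mE.
    have -> : (\sum_(tau : {perm T}) [forall i in I, [ffun i => tau i] i == c i] =
       \sum_(tau : {perm T} | all (fun x => tau x == c x) (enum I)) 1)%N.
      rewrite [RHS]big_mkcond; apply: eq_bigr => tau _.
      rewrite (_ : [forall i in I, _] = all (fun x => tau x == c x) (enum I)).
        by case: all.
      apply/forall_inP/allP => h i; last by rewrite ffunE => iI; apply: h; rewrite mem_enum.
      by rewrite mem_enum => /h; rewrite ffunE.
    by apply/eqP; rewrite mulr1 -[eqbRHS]mul1r eqr_div // -natrM mE mul1r.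
  rewrite leqNgt (ltn_neqAle v) ncinj vI /= mulr0 big1 ?mul0r // => tau _.
  case: forall_inP => // cE; case/imset_injP: ncinj => i j iI jI cij.
  apply: (@perm_inj _ tau).
  by have := cE i iI; have := cE j jI; rewrite !ffunE => /eqP -> /eqP ->.
have r0 : #|A|%:R != 0 :> F by rewrite pnatr_eq0 -lt0n.
rewrite sum_small_range_law (eq_bigr _ (fun tau _ => count_small_range A I c tau)).
rewrite -big_distrl /=.
have -> : (\sum_(tau : {perm T}) all (fun y => tau y \in A) (enum (c @: I)) =
    \sum_(tau : {perm T} | all (fun y => tau y \in A) (enum (c @: I))) 1)%N.
  by rewrite [RHS]big_mkcond; apply: eq_bigr => tau _; case: all.
have := card_perm_into A (enum_uniq (c @: I)); rewrite -cardE -/v -/m => mE.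
rewrite hornerZ hornerM horner_falling_polyV // hornerXn.
have vm' : (#|I| <= m)%N := max_card _.
rewrite !natrM !natrX exprVn.
have -> : #|A|%:R ^+ m = #|A|%:R ^+ (m - #|I|) * #|A|%:R ^+ (#|I| - v) * #|A|%:R ^+ v :> F.
  by rewrite -mulrA -!exprD !subnK.
have {}mE := congr1 (fun n => n%:R : F) mE; rewrite !natrM in mE.
apply: (mulIf mv0); rewrite [LHS]mulrAC [X in X / _ = _]mulrAC mE.
by field; rewrite mv0 m0 !expf_neq0.
Qed.

(** A monomial that asks for two values at one point vanishes. Otherwise, the entries being 0 or 1,
    only the positions of the positive exponents matter. *)
Lemma map_monomial_partial_map e :
  (forall g, map_monomial e g = 0) \/
  exists I c, (#|I| <= \sum_i \sum_j e i j)%N /\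
    forall g, map_monomial e g = [forall i in I, g i == c i]%:R.
Proof.
pose I := [set i | [exists j, 0 < e i j]%N].
pose c i := odflt i [pick j | 0 < e i j]%N.
have cP i : i \in I -> (0 < e i (c i))%N.
  by rewrite inE /c; case: pickP => //= e0 /existsP[j]; rewrite e0.
have [/existsP[i /existsP[j /andP[jc eij]]]|uniq_c] :=
    boolP [exists i, [exists j, (j != c i) && (0 < e i j)%N]].
  left=> g; have eic : (0 < e i (c i))%N by apply: cP; rewrite inE; apply/existsP; exists j.
  rewrite /map_monomial (bigD1 i) //= (bigD1 j) //= (bigD1 (c i)) 1?eq_sym //=.
  have [gj|_] := eqVneq (g i) j; last by rewrite expr0n gtn_eqF // !mul0r.
  by rewrite gj (negbTE jc) (expr0n _ (e i (c i))) gtn_eqF // mul0r mulr0 mul0r.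
right; exists I, c; split.
  rewrite -sum1_card [X in (_ <= X)%N](bigID [in I]) /=; apply: leq_trans (leq_addr _ _).
  by apply: leq_sum => i iI; rewrite (bigD1 (c i)) //= ltn_addr // cP.
have e0 i j : j != c i -> e i j = 0%N.
  move=> jc; apply/eqP; rewrite -leqn0 leqNgt; apply: contraNN uniq_c => eij.
  by apply/existsP; exists i; apply/existsP; exists j; rewrite jc.
move=> g; rewrite -prod_nat_bool natr_prod; apply: eq_bigr => i _.
rewrite (bigD1 (c i)) //= big1 ?mulr1 => [|j /e0 ->]; last exact: expr0.
have [iI|iI] := boolP (i \in I).
  by case: eqP => _; rewrite ?expr1n // expr0n gtn_eqF ?cP.
have -> : e i (c i) = 0%N.
  apply/eqP; rewrite -leqn0 leqNgt; apply: contraNN iI => eic.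
  by rewrite inE; apply/existsP; exists (c i).
by rewrite expr0.
Qed.

Lemma map_monomial_poly e :
  exists2 H : {poly F}, (size H <= (\sum_i \sum_j e i j).+1)%N &
  \sum_g perm_law g * map_monomial e g = H.[0] /\
  forall A, (0 < #|A|)%N ->
    \sum_g small_range_law A g * map_monomial e g = H.[#|A|%:R^-1].
Proof.
have [e0|[I [c [Ie eE]]]] := map_monomial_partial_map e.
  exists 0; first by rewrite size_poly0.
  by split=> [|A _]; rewrite horner0 big1 // => g _; rewrite e0 mulr0.
have [H sH [Hperm Hsmall]] := partial_map_poly I c.
exists H; first exact: leq_trans sH _.
by split=> [|A /Hsmall <-]; rewrite -?Hperm; apply: eq_bigr => g _; rewrite eE.
Qed.

Lemma perm_law_ge0 g : 0 <= perm_law g.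
Proof. by rewrite divr_ge0 ?ler0n. Qed.

Lemma small_range_law_ge0 A g : 0 <= small_range_law A g.
Proof. by rewrite divr_ge0 ?ler0n. Qed.

Lemma sum_perm_law1 : \sum_g perm_law g = 1.
Proof.
under eq_bigr do rewrite -[perm_law _]mulr1.
rewrite (sum_perm_law (fun=> true)) sum_nat_const card_permT muln1 divff //.
by rewrite pnatr_eq0 -lt0n fact_gt0.
Qed.

(** With no prescribed value the polynomial is constant, so the mass is that of [perm_law]. *)
Lemma sum_small_range_law1 A : (0 < #|A|)%N -> \sum_g small_range_law A g = 1.
Proof.
move=> A0; have [H sH [Hperm Hsmall]] := partial_map_poly finset.set0 id.
rewrite cards0 in sH; rewrite (size1_polyC sH) in Hperm Hsmall.
have sT g : [forall i in finset.set0, g i == i].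
  by apply/forall_inP => i; rewrite inE.
have := Hsmall A A0; rewrite hornerC -[H`_0](hornerC _ 0) -Hperm.
under eq_bigr do rewrite sT mulr1.
by under [RHS]eq_bigr do rewrite sT mulr1; rewrite sum_perm_law1.
Qed.

Lemma perm_law_supp g : perm_law g != 0 -> injective g.
Proof.
move=> gn0; have /existsP[tau /forallP tg] : [exists tau : {perm T}, [forall i, tau i == g i]].
  apply: contraNT gn0 => /existsPn tau0; rewrite /perm_law big1 ?mul0r // => tau _.
  by rewrite (negbTE (tau0 tau)).
by move=> i j; rewrite -!(eqP (tg _)); apply: perm_inj.
Qed.

Lemma small_range_law_supp A g : small_range_law A g != 0 -> (#|g @: T| <= #|A|)%N.
Proof.
move=> gn0; have /existsP[tau /forallP tg] : [exists tau : {perm T}, [forall i, tau (g i) \in A]].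
  apply: contraNT gn0 => /existsPn tau0; rewrite /small_range_law big1 ?mul0r // => tau _.
  by rewrite (negbTE (tau0 tau)).
rewrite -(card_preimset A (@perm_inj _ tau)); apply: subset_leq_card.
by apply/fintype.subsetP => _ /imsetP[i _ ->]; rewrite inE.
Qed.

End RandomMaps.

(** * Extrapolation to zero *)

Section Interpolation.
Variable F : realFieldType.

Lemma lagrange_at0 N (x : 'I_N -> F) (p : {poly F}) :
  injective x -> (size p <= N)%N ->
  p.[0] = \sum_i (\prod_(j | j != i) (x j / (x j - x i))) * p.[x i].
Proof.
move=> xinj sp.
pose ell i : {poly F} := \prod_(j | j != i) ((x j - x i)^-1 *: ((x j)%:P - 'X)).
have ellE i z : (ell i).[z] = \prod_(j | j != i) ((x j - z) / (x j - x i)).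
  rewrite horner_prod; apply: eq_bigr => j _.
  by rewrite hornerZ hornerD hornerN hornerC hornerX mulrC.
have s1 j : size ((x j)%:P - 'X : {poly F}) = 2%N.
  by rewrite -opprB size_polyN size_XsubC.
have sell i : (size (ell i) <= N)%N.
  rewrite /ell scaler_prod; apply: leq_trans (size_scale_leq _ _) _.
  apply: leq_trans (size_poly_prod_leq _ _) _.
  rewrite (eq_bigr (fun=> 2%N)) => [|j _]; last exact: s1.
  rewrite sum_nat_const (cardC1 i) card_ord.
  by have := ltn_ord i; lia.
pose q := p - \sum_i p.[x i] *: ell i.
have q0 : q = 0.
  apply: (@roots_geq_poly_eq0 _ _ [seq x i | i <- enum 'I_N]).
  - apply/allP => _ /mapP[i _ ->]; rewrite /root hornerD hornerN horner_sum.
    rewrite (bigD1 i) //= big1 => [|j ji]; rewrite hornerZ ellE.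
      rewrite big1 ?mulr1 ?addr0 ?subrr // => j ji.
      by rewrite divff // subr_eq0 (inj_eq xinj).
    by rewrite (bigD1 i) 1?eq_sym //= subrr !mul0r mulr0.
  - by rewrite map_inj_uniq // enum_uniq.
  - rewrite size_map size_enum_ord; apply: leq_trans (size_polyD _ _) _.
    rewrite geq_max sp size_polyN; apply: leq_trans (size_sum _ _ _) _.
    apply/bigmax_leqP => i _; apply: leq_trans (size_scale_leq _ _) _.
    exact: sell.
have pE : p = \sum_i p.[x i] *: ell i by apply/eqP; rewrite -subr_eq0 -/q q0.
rewrite {1}pE horner_sum; apply: eq_bigr => i _.
rewrite hornerZ ellE mulrC; congr (_ * _).
by apply: eq_bigr => j _; rewrite subr0.
Qed.

(* The nodes [1 / r t] grow at least as fast as [y t]; this can only decrease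
   the Lagrange weights at [0]. *)
Lemma node_ratio_le (r y : nat -> nat) s t : s != t ->
    (0 < r s)%N -> (0 < r t)%N ->
    {homo y : a b / (a < b)%N} ->
    (forall a b, (a <= b)%N -> (r b * y b <= r a * y a)%N) ->
  `|(r s)%:R^-1 / ((r s)%:R^-1 - (r t)%:R^-1)| <=
    (y s)%:R / `|(y s)%:R - (y t)%:R| :> F.
Proof.
move=> st rs0 rt0 yinc ry.
have rs0' : 0 < (r s)%:R :> F by rewrite ltr0n.
have rt0' : 0 < (r t)%:R :> F by rewrite ltr0n.
have -> : (r s)%:R^-1 / ((r s)%:R^-1 - (r t)%:R^-1) =
    (r t)%:R / ((r t)%:R - (r s)%:R) :> F.
  have -> : (r s)%:R^-1 - (r t)%:R^-1 = ((r t)%:R - (r s)%:R) / ((r s)%:R * (r t)%:R) :> F.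
    by field; rewrite (gt_eqF rs0') (gt_eqF rt0').
  by rewrite invf_div !mulrA mulVf ?mul1r // gt_eqF.
rewrite normrM normfV ger0_norm ?ler0n //.
have [lt_st|lt_ts|e] := ltngtP s t; last by rewrite e eqxx in st.
  have ys := yinc _ _ lt_st; have ryst := ry _ _ (ltnW lt_st).
  have rst : (r t < r s)%N by nia.
  rewrite ltr0_norm ?subr_lt0 ?ltr_nat // ltr0_norm ?subr_lt0 ?ltr_nat // !opprB.
  rewrite ler_pdivrMr ?subr_gt0 ?ltr_nat // mulrAC ler_pdivlMr ?subr_gt0 ?ltr_nat //.
  by rewrite -!natrB ?(ltnW rst) ?(ltnW ys) // -!natrM ler_nat; nia.
have ys := yinc _ _ lt_ts; have ryst := ry _ _ (ltnW lt_ts).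
have rst : (r s < r t)%N.
  have: (r s * y s < r t * y s)%N by nia.
  by rewrite ltn_mul2r => /andP[].
rewrite gtr0_norm ?subr_gt0 ?ltr_nat // gtr0_norm ?subr_gt0 ?ltr_nat //.
rewrite ler_pdivrMr ?subr_gt0 ?ltr_nat // mulrAC ler_pdivlMr ?subr_gt0 ?ltr_nat //.
by rewrite -!natrB ?(ltnW rst) ?(ltnW ys) // -!natrM ler_nat; nia.
Qed.

(** The modulus of the Lagrange weight at 0 of the node [t ^ 2], the other nodes being the squares
    up to [d ^ 2]. Letting [t] exceed [d] permits induction on [d]. *)
Definition square_weight (d t : nat) : F :=
  \prod_(s < d | s.+1 != t) ((s.+1 ^ 2)%:R / `|(s.+1 ^ 2)%:R - (t ^ 2)%:R|).

Lemma square_weightS d t : d.+1 != t -> square_weight d.+1 t =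
  square_weight d t * ((d.+1 ^ 2)%:R / `|(d.+1 ^ 2)%:R - (t ^ 2)%:R|).
Proof. by move=> dt; rewrite /square_weight big_mkcond big_ord_recr /= dt -big_mkcond. Qed.

Lemma square_weight_below d u :
  square_weight d (d + u).+1 * (((d + u).+1 + d)`!)%:R =
  (d`! ^ 2 * (d + u).+1 * u`!)%:R.
Proof.
elim: d u => [|d IHd] u.
  by rewrite /square_weight big_ord0 add0n addn0 mul1r factS fact0 !mul1n.
rewrite square_weightS ?ltn_eqF //; last by lia.
have -> : `|(d.+1 ^ 2)%:R - ((d.+1 + u).+1 ^ 2)%:R| =
    (u.+1 * ((d.+1 + u).+1 + d).+1)%:R :> F.
  rewrite distrC ger0_norm ?subr_ge0 ?ler_nat ?leq_exp2r //; last by lia.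
  by rewrite -natrB ?leq_exp2r //; [congr (_%:R); lia|lia].
have := IHd u.+1; rewrite addnS -addSn => {}IHd.
have tdE : ((d.+1 + u).+1 + d.+1 = ((d.+1 + u).+1 + d).+1)%N by rewrite addnS.
have KE : (d.+1`! ^ 2 * (d.+1 + u).+1 * u`! * u.+1 =
  d`! ^ 2 * (d.+1 + u).+1 * u.+1`! * d.+1 ^ 2)%N by rewrite !factS; ring.
have u0 : u.+1%:R != 0 :> F by rewrite pnatr_eq0.
apply: (mulIf u0); rewrite -[RHS]natrM KE [RHS]natrM -IHd tdE [in LHS]factS.
move: (square_weight _ _) => W; rewrite [(u.+1 * _)%:R]natrM [(_.+1 * _)%:R]natrM.
have : ((d.+1 + u).+1 + d).+1%:R != 0 :> F by rewrite pnatr_eq0.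
move: (_ %:R) (_%:R) (_%:R) (_%:R) u0.
by move=> a b c e e0 c0; field; rewrite ?e0 ?c0.
Qed.

(** The induction starts from [square_weight_below], as the factor at [t] itself is skipped; each
    node beyond [t] then adds one factor. *)
Lemma square_weight_above u t : (0 < t)%N ->
  square_weight (t + u) t * (u`! * (t + u + t)`!)%:R = (2 * (t + u)`! ^ 2)%:R.
Proof.
case: t => // t _; elim: u => [|u IHu].
  rewrite addn0 /square_weight big_mkcond big_ord_recr /= eqxx mulr1 -big_mkcond /=.
  have := square_weight_below t 0; rewrite addn0 fact0 muln1 => E.
  have -> : ((t.+1 + t.+1)`! = (t.+1 + t)`! * (2 * t.+1))%N.
    by rewrite addnS factS mulnC; congr (_ * _)%N; lia.
  rewrite -/(square_weight t t.+1) mul1n [X in _ * X]natrM mulrA E -natrM factS.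
  by congr (_%:R); ring.
rewrite addnS square_weightS; last by rewrite neq_ltn ltnS leq_addr orbT.
have -> : `|((t.+1 + u).+1 ^ 2)%:R - (t.+1 ^ 2)%:R| =
    (u.+1 * (t.+1 + u + t.+1).+1)%:R :> F.
  rewrite ger0_norm ?subr_ge0 ?ler_nat ?leq_exp2r //; last by lia.
  by rewrite -natrB ?leq_exp2r //; [congr (_%:R); lia|lia].
rewrite (addSn (t.+1 + u)) (factS u) (factS (t.+1 + u + t.+1)) (factS (t.+1 + u)).
rewrite (_ : (u.+1 * u`! * ((t.+1 + u + t.+1).+1 * (t.+1 + u + t.+1)`!))%N =
   (u`! * (t.+1 + u + t.+1)`! * (u.+1 * (t.+1 + u + t.+1).+1))%N); last by ring.
rewrite [X in _ * X = _]natrM mulrACA IHu divfK ?pnatr_eq0 // -natrM.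
by move: (t.+1 + u)`! => f; congr (_%:R); ring.
Qed.

(** Division-free monotonicity in [a] of [(a + t)! / a!], a product of [t] consecutive integers. *)
Lemma fact_mul_le a b t : (a <= b)%N -> ((a + t)`! * b`! <= a`! * (b + t)`!)%N.
Proof.
move=> ab; elim: t => [|t IHt]; first by rewrite !addn0.
by rewrite !addnS !factS -mulnA [X in (_ <= X)%N]mulnCA leq_mul // ltnS leq_add2r.
Qed.

(** The weight is [2 * d! ^ 2 / ((d - t)! * (d + t)!)], twice the ratio of a binomial coefficient of
    [2 d] to the central one. *)
Lemma square_weight_le2 d t : (0 < t <= d)%N -> square_weight d t <= 2.
Proof.
move=> /andP[t0 /subnKC <-]; set u := (d - t)%N.
have f0 : 0 < (u`! * (t + u + t)`!)%:R :> F by rewrite ltr0n muln_gt0 !fact_gt0.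
rewrite -(ler_pM2r f0) square_weight_above // -natrM ler_nat leq_pmul2l //.
by rewrite expnS expn1 -[X in (X`! * _ <= _)%N]addnC fact_mul_le // leq_addl.
Qed.

(** Telescoping, by [1 / (x + 1) ^ 2 <= 1 / x - 1 / (x + 1)]. The inverse of 0 is 0 by convention,
    hence a separate first step. *)
Lemma sum_inv_square d : \sum_(t < d) (t.+1%:R ^+ 2)^-1 <= 2 - d%:R^-1 :> F.
Proof.
elim: d => [|d IHd]; first by rewrite big_ord0 invr0 subr0 ler0n.
rewrite big_ord_recr /=; case: d IHd => [_|d IHd].
  by rewrite big_ord0 !expr1n invr1; lra.
apply: le_trans (lerD IHd (lexx _)) _.
have d1 : 0 < d.+1%:R :> F by rewrite ltr0n.
rewrite -[d.+2%:R]natr1; move: (d.+1%:R) d1 => x x0.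
rewrite -subr_ge0 (_ : _ - _ = (x * (x + 1) ^+ 2)^-1); last by field; lra.
by rewrite invr_ge0 mulr_ge0 ?sqr_ge0 // ltW.
Qed.

(** Target values of [R0 / r_t]. The node at index 0 carries the main weight; the factor 17 keeps
    the other weights at [1 / 4] in total. *)
Definition ref_node t : nat := if t is 0 then 1 else 17 * t ^ 2.

Lemma ref_node_homo : {homo ref_node : a b / (a < b)%N}.
Proof. by case=> [|a] [|b] //=; rewrite ?muln_gt0 ?expn_gt0 // ?ltn_pmul2l ?ltn_exp2r //; lia. Qed.

(** Rounding step by step, rather than taking the integer part of [R0 / ref_node t], keeps
    [node R0 t * ref_node t] nonincreasing, as [node_ratio_le] demands. *)
Fixpoint node (R0 t : nat) : nat :=
  if t is t'.+1 then (node R0 t' * ref_node t') %/ ref_node t else R0.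

Lemma ref_node_gt0 t : (0 < ref_node t)%N.
Proof. by case: t => // t; rewrite muln_gt0 expn_gt0. Qed.

Lemma node_antimono R0 a b : (a <= b)%N ->
  (node R0 b * ref_node b <= node R0 a * ref_node a)%N.
Proof.
move=> /subnKC <-; elim: (b - a)%N => [|k IHk]; first by rewrite addn0.
by rewrite addnS; apply: leq_trans IHk; apply: leq_divM.
Qed.

(** Rounding at index [t] loses less than [17 * t ^ 2], and the first [t] squares sum to at most
    [t ^ 3]. *)
Lemma node_lower R0 t : (R0 <= node R0 t * ref_node t + 17 * t ^ 3)%N.
Proof.
elim: t => [|t IHt]; first by rewrite muln1 leq_addr.
have := ltn_ceil (node R0 t * ref_node t) (ref_node_gt0 t.+1).
move: IHt; rewrite -[(_ %/ _)%N]/(node R0 t.+1).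
move: (node R0 t * _)%N (node R0 t.+1) => a b; rewrite /=; nia.
Qed.

Lemma node_bounds R0 d t : (17 * d ^ 3 < R0)%N -> (t <= d)%N -> (0 < node R0 t <= R0)%N.
Proof.
move=> dR td; apply/andP; split.
  have := node_lower R0 t; have : (t ^ 3 <= d ^ 3)%N by rewrite leq_exp2r.
  by rewrite lt0n; case: eqP => // -> /=; lia.
have := node_antimono R0 (leq0n t); rewrite /= muln1; apply: leq_trans.
by rewrite leq_pmulr // ref_node_gt0.
Qed.

(* Nodes [1 / r] with integers [r <= R0 ~ d ^ 3] suffice to extrapolate
   polynomials of degree [d] from the nodes to [0] with constant loss. *)
Lemma extrapolation_to0 R0 d : (17 * d ^ 3 < R0)%N ->
  exists (r : 'I_d.+1 -> nat) (w : 'I_d.+1 -> F),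
    [/\ forall t, (0 < r t <= R0)%N, \sum_t `|w t| <= 3 / 2 &
      forall p : {poly F}, (size p <= d.+1)%N -> p.[0] = \sum_t w t * p.[(r t)%:R^-1]].
Proof.
move=> dR; have rP (t : 'I_d.+1) := node_bounds dR (leq_ord t).
have r0 t : (t <= d)%N -> (0 < node R0 t)%N by move=> /(node_bounds dR)/andP[].
pose x (t : 'I_d.+1) : F := (node R0 t)%:R^-1.
pose w (t : 'I_d.+1) := \prod_(s | s != t) (x s / (x s - x t)).
have xinj : injective x.
  move=> s t /invr_inj/eqP; rewrite eqr_nat => /eqP st.
  apply/eqP/negPn/negP => nst; wlog lt_st : s t st nst / (s < t)%N.
    move=> H; have [|ts|/val_inj ?] := ltngtP s t; [exact: H | | by subst; rewrite eqxx in nst].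
    by apply: (H t s) => //; rewrite eq_sym.
  have := node_antimono R0 (ltnW lt_st); rewrite st leq_pmul2l ?r0 ?leq_ord //.
  by rewrite leqNgt ref_node_homo.
have interp (p : {poly F}) : (size p <= d.+1)%N -> p.[0] = \sum_t w t * p.[x t].
  exact: lagrange_at0.
exists (fun t => node R0 t), w; split=> //.
(* With [y = (t + 1) ^ 2], the node at index 0 contributes at most [1 / (17 y - 1)] and the others
   at most 2 together. *)
have wle t : `|w (lift ord0 t)| <= (t.+1%:R ^+ 2)^-1 / 8.
  rewrite /w normr_prod.
  apply: (@le_trans _ _ (\prod_(s | s != lift ord0 t)
     ((ref_node s)%:R / `|(ref_node s)%:R - (ref_node t.+1)%:R|))).
    apply: ler_prod => s st; rewrite normr_ge0 /=.
    have := @node_ratio_le (node R0) ref_node s t.+1.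
    apply; rewrite ?r0 ?leq_ord //; first exact: ref_node_homo.
    exact: node_antimono.
  rewrite big_mkcond big_ord_recl /=.
  have -> : \prod_(s < d) (if lift ord0 s != lift ord0 t then
        (ref_node (bump 0 s))%:R / `|(ref_node (bump 0 s))%:R - (17 * t.+1 ^ 2)%N%:R|
      else 1) = square_weight d t.+1 :> F.
    rewrite /square_weight [RHS]big_mkcond; apply: eq_bigr => s _.
    rewrite (inj_eq lift_inj) eqSS val_eqE; case: eqVneq => //= st.
    rewrite !(natrM _ 17) -mulrBr normrM ger0_norm ?ler0n //.
    by rewrite -mulf_div divff ?mul1r // pnatr_eq0.
  have := @square_weight_le2 d t.+1 (ltn_ord t).
  have : 1 <= t.+1%:R ^+ 2 :> F by rewrite -natrX ler1n expn_gt0.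
  rewrite natrM natrX; move: (t.+1%:R ^+ 2) (square_weight d _) => y P y1 P2.
  rewrite ltr0_norm; last by lra.
  have y17 : 0 < 17 * y - 1 by lra.
  rewrite opprB mul1r; apply: (@le_trans _ _ ((17 * y - 1)^-1 * 2)).
    by rewrite ler_pM2l ?invr_gt0.
  rewrite -subr_ge0 (_ : _ - _ = (y - 1) / (8 * y * (17 * y - 1))).
    by apply: divr_ge0; [lra | apply: mulr_ge0; lra].
  by field; apply/andP; split; lra.
have sumw : \sum_(t < d) `|w (lift ord0 t)| <= 1 / 4.
  apply: le_trans (ler_sum _ (fun t _ => wle t)) _; rewrite -mulr_suml.
  have := sum_inv_square d; have : 0 <= d%:R^-1 :> F by rewrite invr_ge0.
  by move: (\sum_(i < d) _) => S; lra.
(* The weights sum to 1, so the first one is at most [5 / 4] in modulus, and the total mass at most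
   [5 / 4 + 1 / 4]. *)
have := interp 1; rewrite size_poly1 hornerC => /(_ isT).
rewrite (eq_bigr w) => [|t _]; last by rewrite hornerC mulr1.
rewrite !big_ord_recl => w1.
have : `|\sum_(t < d) w (lift ord0 t)| <= 1 / 4.
  exact: le_trans (ler_norm_sum _ _ _) sumw.
have -> : w ord0 = 1 - \sum_(t < d) w (lift ord0 t) by rewrite w1 addrK.
move: (\sum_(t < d) w _) => S S4.
have := ler_normB 1 S; rewrite normr1; lra.
Qed.

End Interpolation.

(** * Signed laws of small range with the moments of a random permutation *)

Section SignedLaw.
Variables (F : realFieldType) (T : finType).

Lemma exists_small_range_signed_law R0 d : (17 * d ^ 3 < R0)%N -> (R0 <= #|T|)%N ->
  exists nu : {ffun T -> T} -> F,
    [/\ \sum_g `|nu g| <= 3 / 2,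
        forall g, nu g != 0 -> (#|g @: T| <= R0)%N &
        forall e, (\sum_i \sum_j e i j <= d)%N ->
          \sum_g nu g * map_monomial F e g =
          \sum_g perm_law F g * map_monomial F e g].
Proof.
move=> dR RT; have [r [w [rP w32 wE]]] := @extrapolation_to0 F _ _ dR.
pose A t := [set x in take (r t) (enum T)].
have cA t : #|A t| = r t.
  rewrite cardsE (card_uniqP _) ?take_uniq ?enum_uniq // size_takel // -cardE.
  by have /andP[_ /leq_trans] := rP t; apply.
exists (fun g => \sum_t w t * small_range_law F (A t) g); split.
- apply: le_trans w32; apply: (@le_trans _ _
    (\sum_g \sum_t `|w t| * small_range_law F (A t) g)).
    apply: ler_sum => g _; apply: le_trans (ler_norm_sum _ _ _) _.
    by apply: ler_sum => t _; rewrite normrM (ger0_norm (small_range_law_ge0 _ _ _)).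
  rewrite exchange_big /=; apply: ler_sum => t _.
  rewrite -mulr_sumr sum_small_range_law1 ?mulr1 // cA.
  by case/andP: (rP t).
- move=> g; apply: contra_neqT; rewrite -ltnNge => Rg.
  apply: big1 => t _; have [->|/small_range_law_supp] := eqVneq (small_range_law F (A t) g) 0.
    by rewrite mulr0.
  rewrite cA => gr; have /andP[_ rR] := rP t.
  by have := leq_trans Rg (leq_trans gr rR); rewrite ltnn.
(* Such a moment is a polynomial in [1 / r] whose value at 0 is the permutation moment, so [wE]
   recovers the latter. *)
move=> e ed; have [H sH [HE HA]] := map_monomial_poly F e.
rewrite HE wE; last exact: leq_trans sH _.
under eq_bigr do rewrite mulr_suml.
rewrite exchange_big /=; apply: eq_bigr => t _.
rewrite -cA -HA; last by rewrite cA; case/andP: (rP t).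
by rewrite mulr_sumr; apply: eq_bigr => g _; rewrite [RHS]mulrA.
Qed.

End SignedLaw.

(** * Functions of low degree on the cube *)

Section LowDegree.
Variable F : realFieldType.
Implicit Types f : seq bool -> F.

(* On the cube [{0,1}^k], [f] is a combination of products of at most [g]
   coordinates. *)
Fixpoint low_degree (k g : nat) f : Prop :=
  if k is k'.+1 then
    low_degree k' g (fun s => f (false :: s)) /\
    if g is g'.+1 then low_degree k' g' (fun s => f (true :: s) - f (false :: s))
    else forall s, f (true :: s) = f (false :: s)
  else True.

Lemma low_degree_ext k g f f' : f =1 f' -> low_degree k g f -> low_degree k g f'.
Proof.
elim: k g f f' => [//|k IHk] g f f' ff' [f0 f1]; split.
  by apply: IHk f0 => s.
by case: g f1 {f0} => [f1 s|g f1]; [rewrite -!ff' | apply: IHk f1 => s; rewrite !ff'].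
Qed.

Lemma low_degreeD k g f f' : low_degree k g f -> low_degree k g f' ->
  low_degree k g (fun s => f s + f' s).
Proof.
elim: k g f f' => [//|k IHk] g f f' [f0 f1] [f0' f1']; split; first exact: IHk.
case: g f1 f1' {f0 f0'} => [f1 f1' s|g f1 f1']; first by rewrite f1 f1'.
by apply: low_degree_ext (IHk _ _ _ f1 f1') => s; ring.
Qed.

Lemma low_degreeZ k g a f : low_degree k g f -> low_degree k g (fun s => a * f s).
Proof.
elim: k g f => [//|k IHk] g f [f0 f1]; split; first exact: IHk.
case: g f1 {f0} => [f1 s|g f1]; first by rewrite f1.
by apply: low_degree_ext (IHk _ _ f1) => s; ring.
Qed.

Lemma low_degree0 k g : low_degree k g (fun=> 0).
Proof. by elim: k g => [//|k IHk] [|g]; split=> //; apply: low_degree_ext (IHk g) => s; ring. Qed.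

(** Each factor is affine in its bit, and constant unless its two values differ. *)
Lemma low_degree_prod k g (M : 'I_k -> bool -> F) :
  (#|[pred b | M b true != M b false]| <= g)%N ->
  low_degree k g (fun s => \prod_(b < k) M b (nth false s b)).
Proof.
elim: k g M => [//|k IHk] g M cM.
have cardS : #|[pred b | M b true != M b false]| =
    ((M ord0 true != M ord0 false) +
     #|[pred b : 'I_k | M (lift ord0 b) true != M (lift ord0 b) false]|)%N.
  rewrite -!sum1_card big_mkcond big_ord_recl /= inE -big_mkcond /=.
  by case: (_ != _).
rewrite {}cardS in cM.
have low h : (#|[pred b : 'I_k | M (lift ord0 b) true != M (lift ord0 b) false]| <= h)%N ->
    low_degree k h (fun s => \prod_(b < k) M (lift ord0 b) (nth false s b)).
  exact: (IHk h (fun b => M (lift ord0 b))).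
have prodE c s : \prod_(b < k.+1) M b (nth false (c :: s) b) =
    M ord0 c * \prod_(b < k) M (lift ord0 b) (nth false s b).
  by rewrite big_ord_recl.
split.
  apply: low_degree_ext (low_degreeZ (M ord0 false) (low g _)) => [s|].
    by rewrite prodE.
  exact: leq_trans (leq_addl _ _) cM.
case: g cM => [|g] cM.
  by move=> s; rewrite !prodE; case: eqP cM => [->|].
apply: low_degree_ext (_ : low_degree k g (fun s => (M ord0 true - M ord0 false) *
    \prod_(b < k) M (lift ord0 b) (nth false s b))) => [s|].
  by rewrite !prodE mulrBl.
have [e|ne] := eqVneq (M ord0 true) (M ord0 false).
  by apply: low_degree_ext (low_degree0 k g) => s; rewrite e subrr mul0r.
by apply/low_degreeZ/low; move: cM; rewrite ne.
Qed.

(** Induction on the first bit: the difference has degree [g - 1] and is at most [2 * eps] where at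
    most [g - 1] bits are set, whence a factor [1 + 2] per bit. For [g = 0] the function is
    constant; having no loss there serves the case of a single block. *)
Lemma low_degree_bound k g f eps : low_degree k g f -> 0 <= eps ->
  (forall s, size s = k -> (count id s <= g)%N -> `|f s| <= eps) ->
  `|f (nseq k true)| <= (if g is 0 then 1 else 3 ^+ k) * eps.
Proof.
elim: k g f eps => [|k IHk] g f eps.
  by move=> _ _ H; case: g H => [|g] H; rewrite ?expr0 mul1r; apply: H.
have IH3 h f' eps' : low_degree k h f' -> 0 <= eps' ->
    (forall s, size s = k -> (count id s <= h)%N -> `|f' s| <= eps') ->
    `|f' (nseq k true)| <= 3 ^+ k * eps'.
  move=> lf' eps0 /(IHk _ _ _ lf' eps0) IH; apply: le_trans IH _.
  apply: ler_wpM2r => //.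
  by case: h {lf'} => // ; rewrite exprn_ege1 // ler1n.
case: g => [|g] [lf0 lf1] eps0 H.
  rewrite [nseq _ _]/= lf1; apply: (IHk 0%N (fun s => f (false :: s)) _ lf0 eps0) => s sk s0.
  by apply: H => //=; rewrite sk.
have B0 := IH3 _ _ _ lf0 eps0 (fun s sk sg => H (false :: s) (congr1 S sk) sg).
have B1 : `|f (true :: nseq k true) - f (false :: nseq k true)| <= 3 ^+ k * (2 * eps).
  apply: (IH3 _ _ _ lf1) => [|s sk sg]; first by rewrite mulr_ge0.
  apply: le_trans (ler_normB _ _) _; rewrite mulr_natl mulr2n lerD //.
    by apply: H => /=; rewrite ?sk ?ltnS.
  by apply: H => /=; rewrite ?sk // (leq_trans sg).
rewrite -[f _](subrK (f (false :: nseq k true))) exprS.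
by apply: le_trans (ler_normD _ _) _; lra.
Qed.

End LowDegree.

(** * Block maps as matrices *)

Lemma big_prodType (S : Type) (idx : S) (op : Monoid.com_law idx) (I J : finType)
    (h : I * J -> S) :
  \big[op/idx]_p h p = \big[op/idx]_i \big[op/idx]_j h (i, j).
Proof. by rewrite pair_bigA; apply: eq_bigr => -[]. Qed.

Section BlockMaps.
Variables (R : realType) (n k : nat) (T L : finType).
(** The points: [k] blocks, each a copy of [T], and leftover points [L], which block maps fix. *)
Let U : finType := ('I_k * T + L)%type.
Variables (code : 'I_n -> U) (decode : U -> 'I_n).
Hypotheses (codeK : cancel code decode) (decodeK : cancel decode code).
Implicit Types (f : U -> U) (G : {ffun 'I_k -> {ffun T -> T}}).

Definition block_map G (u : U) : U :=
  match u with inl (b, i) => inl (b, G b i) | inr z => inr z end.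

Definition mx_of_map f : 'M[R]_n := \matrix_(i, j) (f (code i) == code j)%:R.

Lemma row_functional_mx_of_map f : row_functional (mx_of_map f).
Proof.
split=> [i j|i]; first by rewrite mxE; case: eqP; [right|left].
exists (decode (f (code i))); split; first by rewrite mxE decodeK eqxx.
by move=> j; rewrite mxE; case: eqP => [->|_ /eqP]; rewrite ?codeK // eq_sym oner_eq0.
Qed.

Lemma num_nonzero_cols_mx_of_map f : num_nonzero_cols (mx_of_map f) = #|f @: U|.
Proof.
rewrite /num_nonzero_cols -(card_imset _ (can_inj codeK)); apply: eq_card => u.
apply/imsetP/imsetP => [[j]|[v _ ->]].
  rewrite inE => /existsP[i]; rewrite mxE; case: (f (code i) =P code j) => [<- _ ->|_]; first by exists (code i).
  by rewrite eq_sym oner_eq0.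
exists (decode (f v)); rewrite ?decodeK // inE.
by apply/existsP; exists (decode v); rewrite mxE !decodeK !eqxx.
Qed.

Lemma card_imset_block_map_inj G : (forall b, injective (G b)) ->
  #|block_map G @: U| = n.
Proof.
move=> Ginj; rewrite card_imset.
  rewrite -[RHS]card_ord; apply: (bij_eq_card (f := decode)).
  by exists code.
by move=> [[b i]|z] [[b' i']|z'] //= [] // <- /Ginj <-.
Qed.

Lemma card_imset_block_map_le G :
  (#|block_map G @: U| <= \sum_b #|G b @: T| + #|L|)%N.
Proof.
pose S := [set u : U | match u with inl (b, i) => i \in G b @: T | inr _ => true end].
apply: (@leq_trans #|S|).
  apply: subset_leq_card; apply/fintype.subsetP => _ /imsetP[[[b i]|z] _ ->]; rewrite inE //=.
  exact: imset_f.
rewrite -sum1_card big_mkcond big_sumType /=; apply: leq_add; last first.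
  by rewrite (eq_bigr (fun=> 1%N)) ?sum1_card // => z; rewrite inE.
rewrite big_prodType.
apply: leq_sum => b _; rewrite -sum1_card [X in (_ <= X)%N]big_mkcond.
by apply: leq_sum => i _; rewrite inE.
Qed.

(** Entries outside the diagonal blocks do not depend on [G] and go into the constant [c]; the other
    factors group by block. *)
Lemma meval_block_map (mon : multinom (n * n)) :
  exists (c : R) (e : 'I_k -> T -> T -> nat),
    (\sum_b \sum_i \sum_j e b i j <= mdeg mon)%N /\
    forall G, meval (mxvec (mx_of_map (block_map G)) ord0) (mpolyX R mon) =
      c * \prod_b map_monomial R (e b) (G b).
Proof.
pose E (u v : U) := mon (mxvec_index (decode u) (decode v)).
have reindexU (S : Type) (idx : S) (op : Monoid.com_law idx) (h : 'I_(n * n) -> S) :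
    \big[op/idx]_z h z = \big[op/idx]_u \big[op/idx]_v h (mxvec_index (decode u) (decode v)).
  rewrite (reindex _ (curry_mxvec_bij _ _)) /=.
  rewrite big_prodType /=.
  rewrite (reindex decode) /=; last by exists code => x _.
  apply: eq_bigr => u _; rewrite (reindex decode) //=; by exists code => x _.
(* Entries inside a block are replaced by 1; [0 ^+ E u v] is 1 if the exponent is 0. *)
pose out (u : U) (v : U) : R :=
  match u, v with
  | inl (b, i), inl (b', j) => if b == b' then 1 else 0 ^+ E u v
  | inl _, inr _ | inr _, inl _ => 0 ^+ E u v
  | inr z, inr z' => (z == z')%:R ^+ E u v
  end.
exists (\prod_u \prod_v out u v), (fun b i j => E (inl (b, i)) (inl (b, j))); split.
  rewrite mdegE reindexU big_sumType /=; apply: leq_trans (leq_addr _ _).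
  rewrite big_prodType /=.
  apply: leq_sum => b _; apply: leq_sum => i _.
  rewrite big_sumType /=; apply: leq_trans (leq_addr _ _).
  rewrite big_prodType /=.
  by rewrite (bigD1 b) //= leq_addr.
move=> G; rewrite mevalX reindexU.
transitivity (\prod_u ((\prod_v out u v) *
    (if u is inl (b, i) then \prod_j (G b i == j)%:R ^+ E u (inl (b, j)) else 1))); last first.
  rewrite big_split /=; congr (_ * _); rewrite big_sumType /=.
  by rewrite [X in _ * X]big1 ?mulr1 // big_prodType.
apply: eq_bigr => u _; under eq_bigr do rewrite mxvecE mxE !decodeK -/(E _ _).
case: u => [[b i]|z]; last first.
  by rewrite mulr1; apply: eq_bigr => -[[b j]|z'] _.
rewrite !big_sumType /= mulrAC; congr (_ * _).
rewrite !big_prodType /=.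
rewrite (bigD1 b) //= [in RHS](bigD1 b) //= mulrC.
congr (_ * _).
  rewrite [X in _ = X * _]big1 ?mul1r; last by move=> j _; rewrite eqxx.
  apply: eq_bigr => b' bb'; apply: eq_bigr => j _.
  rewrite (eq_sym b) (negbTE bb'); congr (_ ^+ _).
  by case: eqP => // -[e]; rewrite e eqxx in bb'.
by apply: eq_bigr => j _; congr (_ ^+ _); congr (nat_of_bool _)%:R; apply/eqP/eqP => [[]|->].
Qed.

End BlockMaps.

(** * Averaging an approximant over independent block laws *)

Lemma low_degree_sum (F : realFieldType) (I : eqType) (r : seq I) k g
    (f : I -> seq bool -> F) :
  (forall i, i \in r -> low_degree k g (f i)) ->
  low_degree k g (fun s => \sum_(i <- r) f i s).
Proof.
elim: r => [|i r IHr] fl.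
  by apply: low_degree_ext (low_degree0 F k g) => s; rewrite big_nil.
have fr : low_degree k g (fun s => \sum_(i <- r) f i s).
  by apply: IHr => j jr; apply: fl; rewrite inE jr orbT.
apply: low_degree_ext (low_degreeD (fl i (mem_head _ _)) fr) => s.
by rewrite big_cons.
Qed.

Lemma card_ord_bij (U : finType) n : #|U| = n ->
  exists (code : 'I_n -> U) (decode : U -> 'I_n), cancel code decode /\ cancel decode code.
Proof.
move=> <-; exists enum_val, enum_rank; split; [exact: enum_valK|exact: enum_rankK].
Qed.

(** Markov's inequality for the counting measure. *)
Lemma sum_leq_large (I : finType) (h : I -> nat) d :
  (#|[pred b | d < h b]| * d.+1 <= \sum_b h b)%N.
Proof.
rewrite -sum_nat_const [X in (_ <= X)%N](bigID (fun b => d < h b)%N) /=.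
by apply: leq_trans (leq_addr _ _); apply: leq_sum.
Qed.

Lemma block_degree_bound (R : realType) (alpha eps : R) n k m l g d R0
    (p : mpoly (n * n) R) :
    (0 < n)%N -> alpha < 1 -> n = (k * m + l)%N ->
    (17 * d ^ 3 < R0)%N -> (R0 <= m)%N ->
    (g * m + k * R0 + l)%N%:R <= alpha * n%:R ->
    0 <= eps ->
    approximants (mxvec @` @PTP_dom R n alpha)%classic (fun v => PTP (vec_mx v)) eps p ->
    (total_degree p < g.+1 * d.+1)%N ->
  1 - eps <= (if g is 0 then 1 else 3 ^+ k) * ((3 / 2) ^+ k * eps).
Proof.
move=> n0 a1 nE dR Rm cols eps0 approx degp.
pose T : finType := 'I_m; pose L : finType := 'I_l.
have [code [decode [codeK decodeK]]] : exists (code : 'I_n -> 'I_k * T + L)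
    (decode : 'I_k * T + L -> 'I_n), cancel code decode /\ cancel decode code.
  by apply: card_ord_bij; rewrite card_sum card_prod !card_ord nE.
have [|nu [nu32 nuR nuE]] := @exists_small_range_signed_law R T R0 d dR.
  by rewrite card_ord.
pose x G := @mx_of_map R n k T L code (block_map G).
pose P G := meval (mxvec (x G) ord0) p.
pose law (c : bool) := if c then perm_law R (T := T) else nu.
pose wt (s : seq bool) (G : {ffun 'I_k -> {ffun T -> T}}) :=
  \prod_(b < k) law (nth false s b) (G b).
pose u s := \sum_G wt s G * P G.
(* The average of a monomial factors over the blocks, and by [nuE] a factor of degree at most [d]
   ignores its bit. As the total degree is below [(g + 1) * (d + 1)], at most [g] blocks have degree
   above [d]. *)
have u_low : low_degree k g u.
  pose f mon s := mcoeff mon p * \sum_G wt s G * meval (mxvec (x G) ord0) (mpolyX R mon).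
  apply: (@low_degree_ext _ _ _ (fun s => \sum_(mon <- msupp p) f mon s)) => [s|].
    rewrite /u /f; under eq_bigr do rewrite mulr_sumr.
    rewrite exchange_big /=; apply: eq_bigr => G _.
    rewrite /P mevalE mulr_sumr; apply: eq_bigr => mon _.
    by rewrite mevalX mulrCA.
  apply: low_degree_sum => mon mon_p; apply: low_degreeZ.
  have [c [e [emon eE]]] := meval_block_map R codeK decodeK mon.
  apply: (@low_degree_ext _ _ _ (fun s => c * \prod_(b < k)
      \sum_(h : {ffun T -> T}) law (nth false s b) h * map_monomial R (e b) h)) => [s|].
    rewrite bigA_distr_bigA mulr_sumr; apply: eq_bigr => G _.
    by rewrite eE mulrCA big_split.
  apply: low_degreeZ.
  apply: (@low_degree_prod _ _ _ (fun b c => \sum_(h : {ffun T -> T}) law c h * map_monomial R (e b) h)).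
  have monp : (mdeg mon <= total_degree p)%N.
    by rewrite -ltnS; apply: leq_trans (msize_mdeg_lt mon_p) (leqSpred _).
  rewrite -ltnS -(ltn_pmul2r (ltn0Sn d)); apply: leq_ltn_trans degp.
  apply: leq_trans monp; apply: leq_trans emon.
  apply: leq_trans (sum_leq_large _ d).
  rewrite leq_pmul2r //; apply: subset_leq_card; apply/fintype.subsetP => b.
  rewrite !inE; apply: contraR; rewrite -leqNgt => eb.
  by rewrite /law nuE.
have absw s : \sum_G `|wt s G| <= (3 / 2) ^+ k.
  under eq_bigr do rewrite /wt normr_prod.
  rewrite -(bigA_distr_bigA (fun (b : 'I_k) h => `|law (nth false s b) h|)).
  rewrite -[X in _ <= _ ^+ X](card_ord k) -prodr_const; apply: ler_prod => b _.
  rewrite sumr_ge0 //= /law; case: (nth _ _ _) => //.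
  under eq_bigr do rewrite ger0_norm ?perm_law_ge0 //.
  by rewrite sum_perm_law1; lra.
have wt_supp s G (b : 'I_k) : wt s G != 0 -> law (nth false s b) (G b) != 0.
  by rewrite /wt (bigD1 b) //= mulf_eq0 negb_or => /andP[].
have PE G : PTP_dom alpha (x G) ->
    `|P G - PTP (x G)| <= eps.
  move=> xG; have := approx (mxvec (x G)); rewrite mxvecK; apply.
  by exists (x G).
(* A permuted block meets at most [m] columns, any other at most [R0], so by [cols] every matrix of
   nonzero weight has [PTP] equal to 0. *)
have few s : size s = k -> (count id s <= g)%N -> `|u s| <= (3 / 2) ^+ k * eps.
  move=> sk sg; apply: le_trans (ler_norm_sum _ _ _) _.
  apply: le_trans (ler_wpM2r eps0 (absw s)); rewrite mulr_suml; apply: ler_sum => G _.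
  rewrite normrM; have [->|wn0] := eqVneq (wt s G) 0; first by rewrite !normr0 !mul0r.
  apply: ler_wpM2l => //.
  have colx : (num_nonzero_cols (x G) <= g * m + k * R0 + l)%N.
    rewrite (num_nonzero_cols_mx_of_map R codeK decodeK); apply: leq_trans (card_imset_block_map_le _ _) _.
    rewrite card_ord leq_add2r.
    apply: (@leq_trans (\sum_(b < k) (nth false s b * m + R0))).
      apply: leq_sum => b _; have := wt_supp _ _ b wn0; rewrite /law.
      case: (nth _ _ _) => [_|/nuR]; last by rewrite mul0n add0n.
      by rewrite mul1n; apply: leq_trans (max_card _) _; rewrite card_ord leq_addr.
    rewrite big_split /= sum_nat_const card_ord leq_add2r -big_distrl /= leq_mul2r.
    apply/orP; right; apply: leq_trans sg.
    rewrite -sumn_count sumnE big_map (big_nth false) sk big_mkord.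
    by [].
  have xs : (num_nonzero_cols (x G))%:R <= alpha * n%:R.
    by apply: le_trans cols; rewrite ler_nat.
  have := PE G.
  rewrite /PTP ifF ?subr0; first apply.
    by split; [exact: row_functional_mx_of_map codeK decodeK _|right].
  apply/negP => /eqP E; move: xs; rewrite E ler_pMl ?ltr0n // leNgt a1 //.
have := low_degree_bound u_low _ few; rewrite mulr_ge0 ?exprn_ge0 // => [/(_ isT)|]; last by lra.
apply: le_trans.
have nth_true (b : 'I_k) : nth false (nseq k true) b by rewrite nth_nseq ltn_ord.
(* With all bits true the weights form a probability law on permutation matrices, so the average is
   at least [1 - eps]. *)
have w1 : \sum_G wt (nseq k true) G = 1.
  rewrite /wt -(bigA_distr_bigA (fun (b : 'I_k) h => law (nth false (nseq k true) b) h)) big1 // => b _.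
  by rewrite nth_true /law sum_perm_law1.
have w0 G : 0 <= wt (nseq k true) G.
  by apply: prodr_ge0 => b _; rewrite nth_true perm_law_ge0.
apply: le_trans (ler_norm _).
have -> : 1 - eps = \sum_G wt (nseq k true) G * (1 - eps) by rewrite -mulr_suml w1 mul1r.
apply: ler_sum => G _; have [->|wn0] := eqVneq (wt (nseq k true) G) 0; first by rewrite !mul0r.
apply: ler_wpM2l => //.
have xn : num_nonzero_cols (x G) = n.
  rewrite (num_nonzero_cols_mx_of_map R codeK decodeK) (card_imset_block_map_inj codeK) // => b.
  by have := wt_supp _ _ b wn0; rewrite nth_true; apply: perm_law_supp.
have : `|P G - PTP (x G)| <= eps.
  apply: PE.
  by split; [exact: row_functional_mx_of_map codeK decodeK _|left].
by rewrite /PTP xn eqxx ler_distl => /andP[].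
Qed.

(** * The lower bound *)

Lemma cube_root_bounds R0 : (0 < R0)%N -> exists d, (17 * d ^ 3 < R0 <= 17 * d.+1 ^ 3)%N.
Proof.
move=> R0gt0; have ex : exists d, (R0 <= 17 * d.+1 ^ 3)%N.
  by exists R0; have := leq_pexp2l (ltn0Sn R0) (isT : 1 <= 3)%N; rewrite expn1; lia.
case: (ex_minnP ex) => -[|d] R0d dmin; first by exists 0%N; rewrite R0d andbT.
exists d.+1; rewrite R0d andbT ltnNge; apply/negP => /dmin.
by rewrite ltnn.
Qed.

Lemma ln_le_pred (R : realType) (x : R) : 0 < x -> ln x <= x - 1.
Proof. by move=> x0; have := @le_ln1Dx R (x - 1); rewrite [1 + _]addrC subrK; apply; lra. Qed.

(** Since [(9 / 2) ^ 2 <= 81], the left side is at most the square root of [eps], which is below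
    [1 - eps] for [eps <= 1 / 3]. Squaring avoids the root. *)
Lemma block_error_gap (R : realType) (eps : R) k : 0 < eps -> eps <= 1 / 3 ->
  81 ^+ k * eps <= 1 -> 3 ^+ k * ((3 / 2) ^+ k * eps) < 1 - eps.
Proof.
move=> e0 e3 k81; rewrite mulrA -exprMn.
set t := (3 * (3 / 2)) ^+ k.
have t0 : 0 <= t by rewrite exprn_ge0 //; lra.
have t81 : t ^+ 2 <= 81 ^+ k.
  by rewrite /t -exprM mulnC exprM; apply: lerXn2r; rewrite ?nnegrE ?exprn_ge0 //; nra.
rewrite ltNge; apply/negP => le_t.
have : (1 - eps) ^+ 2 <= (t * eps) ^+ 2.
  by rewrite lerXn2r // nnegrE; [lra | apply: mulr_ge0 => //; exact: ltW].
have : t ^+ 2 * eps <= 1 by apply: le_trans k81; rewrite ler_wpM2r // ltW.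
by move: (t) => s; nra.
Qed.

Lemma approx_deg_cube_ge (R : realType) (alpha eps : R) n (L := ln (1 / eps)) :
    0 < alpha -> alpha < 1 -> (1 <= n)%N -> 1 <= alpha * n%:R ->
    3 ^- n <= eps -> eps <= 1 / 3 ->
  0 < L /\ (alpha ^+ 2 / 1000) ^+ 3 * n%:R * L ^+ 2 <=
    (approx_deg (mxvec @` @PTP_dom R n alpha)%classic
       (fun v => PTP (vec_mx v)) eps)%:R ^+ 3.
Proof.
move=> a0 a1 n1 an e3n e3.
have e0 : 0 < eps by apply: lt_le_trans e3n; rewrite invr_gt0 exprn_gt0.
have L0 : 0 < L by rewrite ln_gt0 // ltr_pdivlMr //; lra.
have L2n : L <= 2 * n%:R.
  have : L <= ln (3 ^+ n).
    rewrite ler_ln ?posrE ?exprn_gt0 ?divr_gt0 //.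
    by rewrite mul1r -[leRHS]invrK lef_pV2 ?posrE ?invr_gt0 ?exprn_gt0.
  rewrite lnXn // => /le_trans; apply; rewrite -[ln 3 *+ n]mulr_natr ler_wpM2r //.
  by apply: le_trans (ln_le_pred _) _ => //; lra.
split=> //.
have [[p approx <-] _] := approx_degP (fun v => PTP (vec_mx v)) (finite_PTP_dom n alpha) (ltW e0).
set D := total_degree p.
have n0 : 0 < n%:R :> R by rewrite ltr0n.
have D1 : (1 <= D)%N.
  rewrite leqNgt; apply/negP => D1.
  have := @block_degree_bound R alpha eps n 1 n 0 0 0 1 p n1 a1.
  rewrite mul1n addn0 mul0n add0n muln1 => /(_ erefl isT n1 an (ltW e0) approx D1).
  by rewrite expr1; lra.
(* For small [alpha * n] the claimed bound is at most 1, by [L <= 2 * n]. *)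
have [small|large] := ltP (alpha * n%:R) 8.
  apply: (@le_trans _ _ 1); last by rewrite -natrX ler1n expn_gt0 D1.
  have L2 : L ^+ 2 <= (2 * n%:R) ^+ 2 by apply: lerXn2r; rewrite ?nnegrE ?mulr_ge0 ?(ltW L0).
  apply: (@le_trans _ _ ((alpha ^+ 2 / 1000) ^+ 3 * n%:R * (2 * n%:R) ^+ 2)).
    by rewrite ler_wpM2l // mulr_ge0 ?exprn_ge0 ?divr_ge0 ?sqr_ge0 ?ltW.
  rewrite (_ : _ * _ = alpha ^+ 3 * (alpha * n%:R) ^+ 3 * (4 / 1000 ^+ 3)); last by field.
  have : (alpha * n%:R) ^+ 3 <= 8 ^+ 3 by rewrite lerXn2r ?nnegrE ?mulr_ge0 ?ltW.
  have : alpha ^+ 3 <= 1 by rewrite exprn_ile1 ?ltW.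
  have : 0 <= alpha ^+ 3 by rewrite exprn_ge0 ?ltW.
  have : 0 <= (alpha * n%:R) ^+ 3 by rewrite exprn_ge0 ?mulr_ge0 ?ltW.
  by move: (alpha ^+ 3) ((alpha * n%:R) ^+ 3) => x y; nra.
(* Small enough that [k <= kap * L] gives [ln 81 * k <= 80 * k <= L], that is [81 ^ k * eps <= 1].
   If [kap * L < 1], a single block is used. *)
pose kap := alpha / 100.
have kL0 : 0 <= kap * L by rewrite mulr_ge0 ?divr_ge0 ?ltW.
pose k := maxn 1 (Num.truncn (kap * L)).
have /andP[kt1 kt2] := truncn_itv kL0.
have kP : (k = 1%N /\ kap * L < 2) \/ [/\ (1 < k)%N, k%:R <= kap * L & kap * L <= 2 * k%:R].
  rewrite /k; case: (Num.truncn _) kt1 kt2 => [|[|t]] t1 t2; [left|left|right].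
  - by split=> //; lra.
  - by split.
  - have t2' : 1 <= t.+2%:R :> R by rewrite ler1n.
    by rewrite (maxn_idPr _) //; split=> //; move: t2; rewrite -[t.+3%:R]natr1; lra.
have k0 : (0 < k)%N by rewrite leq_maxl.
have k0R : 1 <= k%:R :> R by rewrite ler1n.
have kL : kap * L <= 2 * k%:R by case: kP => [[-> ?]|[]//]; lra.
have kn : k%:R <= alpha * n%:R / 8.
  case: kP => [[-> _]|[_ kkL _]]; first by lra.
  apply: le_trans kkL _; rewrite /kap.
  have : alpha * L <= alpha * (2 * n%:R) by rewrite ler_wpM2l // ltW.
  by lra.
pose m := (n %/ k)%N; pose l := (n %% k)%N.
have nE : n = (k * m + l)%N by rewrite mulnC; exact: divn_eq.
have lk : (l < k)%N by rewrite ltn_mod.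
clearbody k m l.
have nER : n%:R = k%:R * m%:R + l%:R :> R by rewrite -natrM -natrD -nE.
have lkR : l%:R <= k%:R :> R by rewrite ler_nat ltnW.
have l0R : 0 <= l%:R :> R by [].
have m0R : 0 <= m%:R :> R by [].
have an_n : alpha * n%:R <= n%:R by rewrite ler_piMl // ltW.
have am : 7 <= alpha * m%:R.
  have : k%:R * 7 <= k%:R * (alpha * m%:R); last by rewrite ler_pM2l //; lra.
  have : alpha * k%:R <= k%:R by rewrite ler_piMl // ltW.
  have : alpha * l%:R <= alpha * k%:R by rewrite ler_wpM2l // ltW.
  have : alpha * n%:R = k%:R * (alpha * m%:R) + alpha * l%:R by rewrite nER; ring.
  by lra.
have am0 : 0 <= alpha * m%:R / 4 by lra.
(* With [R0] about [alpha * m / 4] and [g] about [alpha * k / 4], each of [g * m] and [k * R0] is at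
   most [alpha * n / 4], while [l <= k <= alpha * n / 8]. *)
pose R0 := Num.truncn (alpha * m%:R / 4); have /andP[R1 R2] := truncn_itv am0.
rewrite -/R0 in R1 R2; clearbody R0; rewrite -[R0.+1%:R]natr1 in R2.
have R0gt0 : (0 < R0)%N by rewrite -(ltr0n R); lra.
have R0m : (R0 <= m)%N.
  rewrite -(ler_nat R); apply: le_trans R1 _.
  have : alpha * m%:R <= m%:R by rewrite ler_piMl // ltW.
  by lra.
have ak0 : 0 <= alpha * k%:R / 4 by rewrite divr_ge0 // mulr_ge0 // ltW.
pose g := Num.truncn (alpha * k%:R / 4); have /andP[g1 g2] := truncn_itv ak0.
rewrite -/g in g1 g2; clearbody g; rewrite -[g.+1%:R]natr1 in g2.
have [d /andP[d1 d2]] := cube_root_bounds R0gt0.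
have kmn : k%:R * m%:R <= n%:R :> R by lra.
have akm : alpha * (k%:R * m%:R) <= alpha * n%:R by rewrite ler_wpM2l // ltW.
have cols : (g * m + k * R0 + l)%N%:R <= alpha * n%:R.
  rewrite !natrD !natrM.
  have : g%:R * m%:R <= alpha * k%:R / 4 * m%:R by rewrite ler_wpM2r.
  have : k%:R * R0%:R <= k%:R * (alpha * m%:R / 4) by rewrite ler_wpM2l.
  by lra.
have degD : (g.+1 * d.+1 <= D)%N.
  rewrite leqNgt; apply/negP => degD.
  have := block_degree_bound n1 a1 nE d1 R0m cols (ltW e0) approx degD.
  apply/negP; rewrite -ltNge.
  (* For [k = 1] the bound [81 ^ k * eps <= 1] may fail, but [g = 0] and extrapolation is free:
     [3 / 2 * eps < 1 - eps]. *)
  case: kP => [[k1 _]|[_ kkL _]].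
    have -> : g = 0%N.
      apply/eqP; rewrite -leqn0 -ltnS -(ltr_nat R).
      by apply: le_lt_trans g1 _; rewrite k1; lra.
    by rewrite k1 expr1; lra.
  have : 81 ^+ k * eps <= 1.
    rewrite -ler_pdivlMr // -ler_ln ?posrE ?exprn_gt0 ?divr_gt0 // -/L lnXn //.
    rewrite -[ln 81 *+ k]mulr_natr; apply: (@le_trans _ _ (80 * k%:R)).
      by rewrite ler_wpM2r //; apply: le_trans (ln_le_pred _) _ => //; lra.
    have : alpha * L <= L by rewrite ler_piMl // ltW.
    by rewrite /kap in kkL; lra.
  move=> /(block_error_gap e0 e3); apply: le_lt_trans.
  apply: ler_wpM2r; first by apply: mulr_ge0; [apply: exprn_ge0; lra | exact: ltW].
  by case: (g) => [|?] /=; rewrite ?lexx // exprn_ege1 // ler1n.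
have DR : (alpha * k%:R / 4) * d.+1%:R <= D%:R.
  apply: le_trans (_ : (g.+1 * d.+1)%N%:R <= _); last by rewrite ler_nat.
  by rewrite natrM ler_wpM2r // -[g.+1%:R]natr1 ltW.
(* Here [R0 > alpha * m / 4 - 1], and [alpha * m >= 7] absorbs the 1. *)
have d3 : alpha * m%:R / 16 <= 17 * d.+1%:R ^+ 3.
  apply: le_trans (_ : R0%:R <= _); first by lra.
  by rewrite -natrX -natrM ler_nat.
have D3 : ((alpha * k%:R / 4) * d.+1%:R) ^+ 3 <= D%:R ^+ 3.
  apply: lerXn2r DR; rewrite nnegrE; last by [].
  by rewrite mulr_ge0.
apply: le_trans D3.
have nkm : 7 / 8 * n%:R <= k%:R * m%:R :> R by lra.
have kL2 : (kap * L) ^+ 2 <= (2 * k%:R) ^+ 2.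
  by apply: lerXn2r kL; rewrite nnegrE // mulr_ge0.
rewrite [leRHS]exprMn.
apply: (@le_trans _ _ ((alpha * k%:R / 4) ^+ 3 * (alpha * m%:R / 272))); last first.
  by rewrite ler_wpM2l ?exprn_ge0 //; lra.
(* Both sides are regrouped for a factorwise comparison: [kap * L] with [2 * k], and [7 / 8 * n]
   with [k * m]. *)
rewrite (_ : (alpha * k%:R / 4) ^+ 3 * (alpha * m%:R / 272) =
  alpha ^+ 4 / 64 / 1088 * ((2 * k%:R) ^+ 2) * (k%:R * m%:R)); last by field.
rewrite (_ : _ * L ^+ 2 = alpha ^+ 4 / 100 / 875 * (kap * L) ^+ 2 * (7 / 8 * n%:R)); last by rewrite /kap; field.
have a4 : 0 <= alpha ^+ 4 by rewrite exprn_ge0 ?ltW.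
have a4' : 0 <= alpha ^+ 4 / 100 / 875 by lra.
apply: ler_pM nkm.
- by rewrite mulr_ge0 ?sqr_ge0.
- by rewrite mulr_ge0 // divr_ge0.
by apply: ler_pM kL2; rewrite ?sqr_ge0 //; lra.
Qed.

Local Open Scope classical_set_scope.
Local Open Scope ring_scope.

(** Cube roots of [approx_deg_cube_ge]. The condition [1 <= alpha * n%:R] sets aside the case where
    the domain contains only permutation matrices and the degree is 0. *)
Theorem theorem3p7 (R : realType) (alpha : R) :
  0 < alpha -> alpha < 1 ->
  exists c : R, 0 < c /\
    forall (n : nat) (eps : R),
      (1 <= n)%N -> 1 <= alpha * n%:R ->
      3 ^- n <= eps -> eps <= 1 / 3 ->
      c * n%:R `^ (1 / 3) * ln (1 / eps) `^ (2 / 3)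
        <= (approx_deg (mxvec @` @PTP_dom R n alpha)
                       (fun v => PTP (vec_mx v)) eps)%:R.
Proof.
move=> a0 a1; have c0 : 0 < alpha ^+ 2 / 1000 by rewrite divr_gt0 // exprn_gt0.
exists (alpha ^+ 2 / 1000); split=> // n eps n1 an e3n e3.
have [L0 deg3] := approx_deg_cube_ge a0 a1 n1 an e3n e3.
rewrite -(@ler_pXn2r _ 3) ?nnegrE //; last first.
  by apply: mulr_ge0 (powR_ge0 _ _); apply: mulr_ge0 (ltW c0) (powR_ge0 _ _).
apply: le_trans deg3; rewrite !exprMn.
have e1 : 1 / 3 * 3 = 1 :> R by field.
have e2 : 2 / 3 * 3 = 2 :> R by field.
rewrite -(powR_mulrn 3 (powR_ge0 n%:R _)) -powRrM e1 powRr1 //.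
by rewrite -(powR_mulrn 3 (powR_ge0 (ln _) _)) -powRrM e2 powR_mulrn // ltW.
Qed.
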